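(* Let $R$ be an $A_\infty$ ring spectrum. There is a canonical equivalence of $\infty$-groupoids $$B\mathrm{Aut}_R(R)\simeq\mathrm{Line}_R,$$ and $\mathrm{Aut}_R(R)\simeq GL_1R$ as monoidal $\infty$-groupoids.
   Context: $\mathrm{Mod}_R$ is the $\infty$-category of (right) $R$-module spectra. $\mathrm{Line}_R\subset\mathrm{Mod}_R$ is the $\infty$-subgroupoid whose objects are the $R$-lines ($R$-modules admitting an $R$-module equivalence to $R$) and whose morphisms are the equivalences between them. $\mathrm{Aut}_R(R)$ is the monoidal subspace of $\mathrm{End}_R(R)=\mathrm{map}_{\mathrm{Mod}_R}(R,R)$ of self-equivalences, and $B\mathrm{Aut}_R(R)$ is the one-object $\infty$-groupoid with automorphism space $\mathrm{Aut}_R(R)$. $GL_1R\subset\Omega^\infty R$ is the monoidal subspace given by the pullback of $\Omega^\infty R\to\pi_0(R)\leftarrow\pi_0(R)^\times$. *)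

(* Defs.v *)
(* Model.  Spectra are symmetric spectra in simplicial sets with the stable
   model structure of Hovey-Shipley-Smith; an A_oo ring spectrum is an
   (associative, not necessarily commutative) symmetric ring spectrum whose
   underlying symmetric spectrum is stably fibrant.  An oo-category is a
   simplicially enriched category, and an equivalence of oo-categories is a
   Dwyer-Kan equivalence.  Mod_R is the simplicial category of
   cofibrant-fibrant objects in the stable (projective) simplicial model
   category of right R-modules.  A monoidal oo-groupoid is a simplicial
   monoid, considered up to zigzags of homomorphisms that are weak
   equivalences. *)

From Stdlib Require Import Relation_Operators.
From mathcomp Require Import all_boot fingroup perm generic_quotient.
From mathcomp Require Import boolp.

Set Implicit Arguments.
Unset Strict Implicit.
Unset Printing Implicit Defensive.

(** * Simplicial sets *)

Definition is_mono m n (f : {ffun 'I_m.+1 -> 'I_n.+1}) : bool :=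
  [forall i : 'I_m.+1, forall j : 'I_m.+1, (i <= j) ==> (f i <= f j)].

(* Morphisms [m] -> [n] of the simplex category. *)
Record mono m n := Mono {
  mono_fun :> {ffun 'I_m.+1 -> 'I_n.+1};
  monoP : is_mono mono_fun }.

Lemma mono_eq m n (f g : mono m n) : f =1 g -> f = g.
Proof.
case: f g => f fP [g gP] /= fg; have {}fg : f = g by apply/ffunP.
by subst g; rewrite (bool_irrelevance fP gP).
Qed.

Lemma mono_le m n (f : mono m n) (i j : 'I_m.+1) : i <= j -> f i <= f j.
Proof. by move=> ij; move/forallP/(_ i)/forallP/(_ j)/implyP: (monoP f); apply. Qed.

Lemma mono_build m n (f : 'I_m.+1 -> 'I_n.+1) :
  (forall i j : 'I_m.+1, i <= j -> f i <= f j) -> is_mono (finfun f).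
Proof. by move=> fP; do 2!apply/forallP=> ?; apply/implyP=> ?; rewrite !ffunE fP. Qed.

Definition mono_id n : mono n n := Mono (@mono_build n n id (fun i j le => le)).

Definition mono_comp m n p (f : mono n p) (g : mono m n) : mono m p :=
  Mono (@mono_build m p (fun i => f (g i))
          (fun i j le => mono_le f (mono_le g le))).

Definition mono_const m n (i : 'I_n.+1) : mono m n :=
  Mono (@mono_build m n (fun _ => i) (fun _ _ _ => leqnn i)).

Lemma mono_compE m n p (f : mono n p) (g : mono m n) i : mono_comp f g i = f (g i).
Proof. by rewrite ffunE. Qed.

Lemma mono_idE n i : mono_id n i = i. Proof. by rewrite ffunE. Qed.

Lemma mono_constE m n (j : 'I_n.+1) i : mono_const m j i = j.
Proof. by rewrite ffunE. Qed.

Lemma mono_comp_id m n (f : mono m n) : mono_comp f (mono_id m) = f.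
Proof. by apply: mono_eq => i; rewrite mono_compE mono_idE. Qed.

Lemma mono_id_comp m n (f : mono m n) : mono_comp (mono_id n) f = f.
Proof. by apply: mono_eq => i; rewrite mono_compE mono_idE. Qed.

Lemma mono_compA m n p q (f : mono p q) (g : mono n p) (h : mono m n) :
  mono_comp f (mono_comp g h) = mono_comp (mono_comp f g) h.
Proof. by apply: mono_eq => i; rewrite !mono_compE. Qed.

Lemma mono_comp_const m n p (j : 'I_p.+1) (g : mono m n) :
  mono_comp (mono_const n j) g = mono_const m j.
Proof. by apply: mono_eq => i; rewrite mono_compE !mono_constE. Qed.

Record sSet := SSet {
  simp :> nat -> Type;
  sact : forall m n, mono m n -> simp n -> simp m;
  sact_id : forall n x, sact (mono_id n) x = x;
  sact_comp : forall m n p (f : mono n p) (g : mono m n) x,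
    sact (mono_comp f g) x = sact g (sact f x) }.

Record sMap (X Y : sSet) := SMap {
  sapp :> forall n, X n -> Y n;
  snat : forall m n (f : mono m n) x, sapp (sact f x) = sact f (sapp x) }.

Arguments sapp {X Y} s {n} x.
Arguments SMap {X Y} sapp snat.

Lemma sMap_eq X Y (f g : sMap X Y) : (forall n (x : X n), f n x = g n x) -> f = g.
Proof.
case: f g => f fn [g gn] /= fg.
have {}fg : f = g by apply: functional_extensionality_dep => n; apply: funext.
by subst g; congr SMap; apply: Prop_irrelevance.
Qed.

(* The vertices of an n-simplex, and the degenerate n-simplex on a vertex. *)
Definition vertex (X : sSet) n (i : 'I_n.+1) (x : X n) : X 0 :=
  sact (mono_const 0 i) x.
Definition degen (X : sSet) n (v : X 0) : X n := sact (mono_const n ord0) v.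

Definition sid X : sMap X X := SMap (fun n x => x) (fun m n f x => erefl).

Lemma scomp_nat X Y Z (g : sMap Y Z) (f : sMap X Y) m n (t : mono m n) x :
  g m (f m (sact t x)) = sact t (g n (f n x)).
Proof. by rewrite !snat. Qed.
Definition scomp X Y Z (g : sMap Y Z) (f : sMap X Y) : sMap X Z :=
  SMap (fun n x => g n (f n x)) (scomp_nat g f).

Definition sprod (X Y : sSet) : sSet.
Proof.
refine (@SSet (fun n => X n * Y n)%type
          (fun m n f xy => (sact f xy.1, sact f xy.2)) _ _).
- by move=> n [x y] /=; rewrite !sact_id.
- by move=> m n p f g [x y] /=; rewrite !sact_comp.
Defined.

Definition spair Z X Y (f : sMap Z X) (g : sMap Z Y) : sMap Z (sprod X Y).
Proof.
refine (@SMap Z (sprod X Y) (fun n z => (f n z, g n z)) _).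
by move=> m n t z /=; rewrite !snat.
Defined.

Definition simplex (n : nat) : sSet :=
  @SSet (fun k => mono k n) (fun k l f t => mono_comp t f)
    (fun k t => mono_comp_id t)
    (fun k l p f g t => mono_compA t f g).

(* The map Delta^k * X -> Delta^n * X induced by [k] -> [n]. *)
Definition sprod_simplex k n (f : mono k n) (X : sSet) :
  sMap (sprod (simplex k) X) (sprod (simplex n) X).
Proof.
refine (@SMap (sprod (simplex k) X) (sprod (simplex n) X)
         (fun j tx => (mono_comp f tx.1, tx.2)) _).
by move=> l m g [t x] /=; rewrite mono_compA.
Defined.

(** Sub-simplicial sets *)

Definition ssub (X : sSet) (P : forall n, X n -> Prop)
  (Pact : forall m n (f : mono m n) x, P n x -> P m (sact f x)) : sSet.
Proof.
refine (@SSet (fun n => {x : X n | P n x})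
          (fun m n f x => exist _ (sact f (sval x)) (Pact _ _ f _ (svalP x))) _ _).
- by move=> n [x Px]; apply: eq_exist; rewrite /= sact_id.
- by move=> m n p f g [x Px]; apply: eq_exist; rewrite /= sact_comp.
Defined.

Lemma vertex_act (X : sSet) m n (f : mono m n) (x : X n) i :
  vertex i (sact f x) = vertex (f i) x.
Proof.
rewrite /vertex -sact_comp; congr sact.
by apply: mono_eq => j; rewrite mono_compE !mono_constE.
Qed.

Lemma vsub_act (X : sSet) (P : X 0 -> Prop) m n (f : mono m n) (x : X n) :
  (forall i, P (vertex i x)) -> forall i, P (vertex i (sact f x)).
Proof. by move=> Px i; rewrite vertex_act. Qed.

(* The full simplicial subset of X on the vertices satisfying P.  When P is
   invariant under paths, it is a union of path components of X. *)
Definition vsub (X : sSet) (P : X 0 -> Prop) : sSet :=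
  @ssub X (fun n x => forall i, P (vertex i x)) (@vsub_act X P).

Lemma bdry_act n m p (f : mono m p) (t : mono p n) :
  (exists j, forall i, t i <> j) -> exists j, forall i, mono_comp t f i <> j.
Proof. by case=> j tj; exists j => i; rewrite mono_compE. Qed.
Definition bdry n : sSet :=
  @ssub (simplex n) (fun m (t : mono m n) => exists j, forall i, t i <> j)
    (@bdry_act n).

Lemma horn_act n (k : 'I_n.+1) m p (f : mono m p) (t : mono p n) :
  (exists2 j, j <> k & forall i, t i <> j) ->
  exists2 j, j <> k & forall i, mono_comp t f i <> j.
Proof. by case=> j jk tj; exists j => // i; rewrite mono_compE. Qed.
Definition horn n (k : 'I_n.+1) : sSet :=
  @ssub (simplex n)
    (fun m (t : mono m n) => exists2 j, j <> k & forall i, t i <> j)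
    (@horn_act n k).

(** Homotopy theory of simplicial sets *)

Definition kan (X : sSet) : Prop :=
  forall n (k : 'I_n.+2) (h : sMap (horn k) X),
  exists H : sMap (simplex n.+1) X,
    forall m (t : horn k m), H m (sval t) = h m t.

Definition trivial_fibration X Y (p : sMap X Y) : Prop :=
  forall n (b : sMap (bdry n) X) (d : sMap (simplex n) Y),
  (forall m (t : bdry n m), p m (b m t) = d m (sval t)) ->
  exists H : sMap (simplex n) X,
    (forall m (t : bdry n m), H m (sval t) = b m t) /\
    (forall m (t : simplex n m), p m (H m t) = d m t).

Definition homotopy1 X Y (f g : sMap X Y) : Prop :=
  exists H : sMap (sprod (simplex 1) X) Y, forall n (x : X n),
    H n (mono_const n ord0, x) = f n x /\ H n (mono_const n ord_max, x) = g n x.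

Definition homotopic X Y : sMap X Y -> sMap X Y -> Prop :=
  clos_refl_sym_trans _ (@homotopy1 X Y).

(* f induces bijections [Y, Z] -> [X, Z] for all Kan complexes Z. *)
Definition weak_equiv X Y (f : sMap X Y) : Prop :=
  forall Z, kan Z ->
    (forall h : sMap X Z, exists h' : sMap Y Z, homotopic (scomp h' f) h) /\
    (forall h h' : sMap Y Z,
       homotopic (scomp h f) (scomp h' f) -> homotopic h h').

Definition path1 (X : sSet) (x y : X 0) : Prop :=
  exists e : X 1, vertex ord0 e = x /\ vertex ord_max e = y.

Definition connected (X : sSet) : X 0 -> X 0 -> Prop :=
  clos_refl_sym_trans _ (@path1 X).

Definition connected_rel (X : sSet) : rel {classic (X 0)} :=
  fun x y => `[< @connected X x y >].

Lemma connected_refl X : reflexive (@connected_rel X).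
Proof. by move=> x; apply/asboolP; apply: rst_refl. Qed.
Lemma connected_sym X : symmetric (@connected_rel X).
Proof. by move=> x y; apply/asboolP/asboolP; apply: rst_sym. Qed.
Lemma connected_trans X : transitive (@connected_rel X).
Proof.
by move=> y x z /asboolP xy /asboolP yz; apply/asboolP; apply: rst_trans xy yz.
Qed.
Canonical connected_equiv X := EquivRel (@connected_rel X)
  (@connected_refl X) (@connected_sym X) (@connected_trans X).

Definition pi0 (X : sSet) := {eq_quot (connected_equiv X)}%qT.

Definition pi0_class (X : sSet) (x : X 0) : pi0 X :=
  \pi_(pi0 X)%qT (x : {classic (X 0)}).
Definition pi0_repr (X : sSet) (c : pi0 X) : X 0 := repr c.

Lemma pi0_classP (X : sSet) (x y : X 0) : pi0_class x = pi0_class y <-> connected x y.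
Proof.
split; first by move/eqmodP/asboolP.
by move=> xy; apply/eqmodP/asboolP.
Qed.

Lemma pi0_reprK X (c : pi0 X) : pi0_class (pi0_repr c) = c.
Proof. exact: reprK. Qed.

Lemma connected_map X Y (f : sMap X Y) (x y : X 0) :
  connected x y -> connected (f 0 x) (f 0 y).
Proof.
elim=> {x y} [x y [e [<- <-]]|x|x y _ IH|x y z _ IH _ IH'].
- by apply: rst_step; exists (f 1 e); rewrite /vertex !snat.
- exact: rst_refl.
- exact: rst_sym.
- exact: rst_trans IH IH'.
Qed.

Lemma degen0 (X : sSet) (x : X 0) : degen 0 x = x.
Proof.
rewrite /degen -[RHS]sact_id; congr sact.
by apply: mono_eq => i; rewrite mono_constE mono_idE ord1.
Qed.

Lemma degen_act (X : sSet) m n (f : mono m n) (x : X 0) :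
  sact f (degen n x) = degen m x.
Proof. by rewrite /degen -sact_comp mono_comp_const. Qed.

Lemma vertex_degen (X : sSet) n (x : X 0) i : vertex i (degen n x) = x.
Proof. by rewrite /vertex degen_act degen0. Qed.

Lemma map_degen X Y (f : sMap X Y) n (x : X 0) : f n (degen n x) = degen n (f 0 x).
Proof. by rewrite /degen snat. Qed.

Definition sconst (X Y : sSet) (y : Y 0) : sMap X Y.
Proof.
refine (@SMap X Y (fun n _ => degen n y) _).
by move=> m n f x; rewrite degen_act.
Defined.

Lemma connected_map2 X Y Z (f : sMap (sprod X Y) Z) (x x' : X 0) (y y' : Y 0) :
  connected x x' -> connected y y' -> connected (f 0 (x, y)) (f 0 (x', y')).
Proof.
move=> xx yy; apply: (@rst_trans _ _ _ (f 0 (x', y))).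
- have := connected_map (scomp f (spair (sid X) (sconst X y))) xx.
  by rewrite /= degen0.
- have := connected_map (scomp f (spair (sconst Y x') (sid Y))) yy.
  by rewrite /= degen0.
Qed.

(** * Simplicial monoids *)

Record sMonoid := SMonoid {
  mon_sset :> sSet;
  mon_mul : sMap (sprod mon_sset mon_sset) mon_sset;
  mon_one : mon_sset 0;
  mon_mulA : forall n (x y z : mon_sset n),
    mon_mul n (x, mon_mul n (y, z)) = mon_mul n (mon_mul n (x, y), z);
  mon_mul1 : forall n (x : mon_sset n), mon_mul n (degen n mon_one, x) = x;
  mon_1mul : forall n (x : mon_sset n), mon_mul n (x, degen n mon_one) = x }.

Record sMonHom (A B : sMonoid) := SMonHom {
  hom_map :> sMap A B;
  hom_mul : forall n (x y : A n),
    hom_map n (mon_mul A n (x, y)) = mon_mul B n (hom_map n x, hom_map n y);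
  hom_one : hom_map 0 (mon_one A) = mon_one B }.

Definition monoidal_equiv : sMonoid -> sMonoid -> Prop :=
  clos_refl_sym_trans _
    (fun A B => exists f : sMonHom A B, weak_equiv f).

Definition pi0_mul (A : sMonoid) (a b : pi0 A) : pi0 A :=
  pi0_class (mon_mul A 0 (pi0_repr a, pi0_repr b)).
Definition pi0_one (A : sMonoid) : pi0 A := pi0_class (mon_one A).
Definition pi0_unit (A : sMonoid) (a : pi0 A) : Prop :=
  exists b, pi0_mul a b = pi0_one A /\ pi0_mul b a = pi0_one A.

Lemma pi0_mulE (A : sMonoid) (x y : A 0) :
  pi0_mul (pi0_class x) (pi0_class y) = pi0_class (mon_mul A 0 (x, y)).
Proof.
by apply/pi0_classP/connected_map2; apply/pi0_classP; rewrite pi0_reprK.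
Qed.

Lemma mon_mul1_0 (A : sMonoid) (x : A 0) : mon_mul A 0 (mon_one A, x) = x.
Proof. by rewrite -{2}(mon_mul1 x) degen0. Qed.
Lemma mon_1mul_0 (A : sMonoid) (x : A 0) : mon_mul A 0 (x, mon_one A) = x.
Proof. by rewrite -{2}(mon_1mul x) degen0. Qed.

Lemma pi0_mulA (A : sMonoid) (a b c : pi0 A) :
  pi0_mul a (pi0_mul b c) = pi0_mul (pi0_mul a b) c.
Proof.
by rewrite -(pi0_reprK a) -(pi0_reprK b) -(pi0_reprK c) !pi0_mulE mon_mulA.
Qed.
Lemma pi0_mul1 (A : sMonoid) (a : pi0 A) : pi0_mul (pi0_one A) a = a.
Proof. by rewrite -(pi0_reprK a) pi0_mulE mon_mul1_0. Qed.
Lemma pi0_1mul (A : sMonoid) (a : pi0 A) : pi0_mul a (pi0_one A) = a.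
Proof. by rewrite -(pi0_reprK a) pi0_mulE mon_1mul_0. Qed.

Lemma pi0_unit_one (A : sMonoid) : pi0_unit (pi0_one A).
Proof. by exists (pi0_one A); rewrite pi0_mul1. Qed.
Lemma pi0_unit_mul (A : sMonoid) (a b : pi0 A) :
  pi0_unit a -> pi0_unit b -> pi0_unit (pi0_mul a b).
Proof.
move=> [a' [aa' a'a]] [b' [bb' b'b]]; exists (pi0_mul b' a'); split.
- by rewrite -pi0_mulA (pi0_mulA b) bb' pi0_mul1.
- by rewrite -pi0_mulA (pi0_mulA a') a'a pi0_mul1.
Qed.

Lemma vertex_map X Y (f : sMap X Y) n i (x : X n) :
  vertex i (f n x) = f 0 (vertex i x).
Proof. by rewrite /vertex snat. Qed.

Definition vsub_map2 (X Y Z : sSet) (P : X 0 -> Prop) (Q : Y 0 -> Prop) (S : Z 0 -> Prop)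
  (f : sMap (sprod X Y) Z)
  (fP : forall x y, P x -> Q y -> S (f 0 (x, y))) :
  sMap (sprod (vsub P) (vsub Q)) (vsub S).
Proof.
unshelve refine (@SMap (sprod (vsub P) (vsub Q)) (vsub S)
  (fun n xy => exist _ (f n (sval xy.1, sval xy.2)) _) _).
- by move=> i /=; rewrite vertex_map; apply: fP; [apply: (svalP xy.1)|apply: (svalP xy.2)].
- by move=> m n t [[x Px] [y Qy]]; apply: eq_exist => /=; rewrite -snat.
Defined.

Lemma vsub_vertexP (X : sSet) (P : X 0 -> Prop) (x : X 0) :
  P x -> forall i, P (vertex i x).
Proof. by move=> Px i; rewrite (ord1 i) [vertex _ _]degen0. Qed.

Lemma vsub_degen (X : sSet) (P : X 0 -> Prop) n (x : vsub P 0) :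
  sval (degen n x) = degen n (sval x).
Proof. by []. Qed.

(* The simplicial submonoid of A on a submonoid of its vertices. *)
Definition sub_monoid (A : sMonoid) (P : A 0 -> Prop) (P1 : P (mon_one A))
  (PM : forall x y, P x -> P y -> P (mon_mul A 0 (x, y))) : sMonoid.
Proof.
refine (@SMonoid (vsub P) (vsub_map2 PM)
          (exist _ (mon_one A) (vsub_vertexP P1)) _ _ _).
- by move=> n x y z; apply: eq_exist; rewrite /= mon_mulA.
- by move=> n [x Px]; apply: eq_exist; rewrite /= mon_mul1.
- by move=> n [x Px]; apply: eq_exist; rewrite /= mon_1mul.
Defined.

(** * Simplicial categories *)

Record sCat := SCat {
  ob :> Type;
  hom : ob -> ob -> sSet;
  idn : forall X, hom X X 0;
  comp : forall X Y Z, sMap (sprod (hom Y Z) (hom X Y)) (hom X Z);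
  compA : forall W X Y Z n (h : hom Y Z n) (g : hom X Y n) (f : hom W X n),
    comp W Y Z n (h, comp W X Y n (g, f)) =
    comp W X Z n (comp X Y Z n (h, g), f);
  comp1f : forall X Y n (f : hom X Y n), comp X Y Y n (degen n (idn Y), f) = f;
  compf1 : forall X Y n (f : hom X Y n), comp X X Y n (f, degen n (idn X)) = f }.

Arguments hom {s} X Y.
Arguments idn {s} X.
Arguments comp {s} X Y Z.

Record sFunctor (C D : sCat) := SFunctor {
  fob :> C -> D;
  fhom : forall X Y, sMap (hom X Y) (hom (fob X) (fob Y));
  fidn : forall X, fhom X X 0 (idn X) = idn (fob X);
  fcomp : forall X Y Z n (g : hom Y Z n) (f : hom X Y n),
    fhom X Z n (comp X Y Z n (g, f)) =
    comp (fob X) (fob Y) (fob Z) n (fhom Y Z n g, fhom X Y n f) }.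

(* Morphisms that become isomorphisms in the homotopy category pi_0 C. *)
Definition is_equiv (C : sCat) (X Y : C) (f : hom X Y 0) : Prop :=
  exists g : hom Y X 0,
    connected (comp X Y X 0 (g, f)) (idn X) /\
    connected (comp Y X Y 0 (f, g)) (idn Y).

Definition equivalent (C : sCat) (X Y : C) : Prop :=
  exists f : hom X Y 0, is_equiv f.

Definition dk_equiv C D (F : sFunctor C D) : Prop :=
  (forall X Y : C, weak_equiv (fhom F X Y)) /\
  (forall Y : D, exists X : C, equivalent (F X) Y).

Definition is_groupoid (C : sCat) : Prop :=
  forall (X Y : C) (f : hom X Y 0), is_equiv f.

Definition groupoid_equiv C D (F : sFunctor C D) : Prop :=
  [/\ is_groupoid C, is_groupoid D & dk_equiv F].

Lemma comp1f_0 (C : sCat) (X Y : C) (f : hom X Y 0) : comp X Y Y 0 (idn Y, f) = f.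
Proof. by rewrite -[RHS]comp1f degen0. Qed.
Lemma compf1_0 (C : sCat) (X Y : C) (f : hom X Y 0) : comp X X Y 0 (f, idn X) = f.
Proof. by rewrite -[RHS]compf1 degen0. Qed.

Lemma is_equiv_idn (C : sCat) (X : C) : is_equiv (idn X).
Proof. by exists (idn X); rewrite comp1f_0; split; apply: rst_refl. Qed.

Lemma is_equiv_comp (C : sCat) (X Y Z : C) (g : hom Y Z 0) (f : hom X Y 0) :
  is_equiv g -> is_equiv f -> is_equiv (comp X Y Z 0 (g, f)).
Proof.
move=> [g' [g'g gg']] [f' [f'f ff']]; exists (comp Z Y X 0 (f', g')); split.
- rewrite -compA (@compA C X Y Z Y).
  apply: rst_trans f'f.
  apply: connected_map2; first exact: rst_refl.
  by rewrite -[X in connected _ X]comp1f_0; apply: connected_map2 => //; apply: rst_refl.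
- rewrite -compA (@compA C Z Y X Y).
  apply: rst_trans gg'.
  apply: connected_map2; first exact: rst_refl.
  by rewrite -[X in connected _ X]comp1f_0; apply: connected_map2 => //; apply: rst_refl.
Qed.

Definition full_sub (C : sCat) (P : C -> Prop) : sCat :=
  @SCat {X : C | P X} (fun X Y => hom (sval X) (sval Y))
    (fun X => idn (sval X)) (fun X Y Z => comp (sval X) (sval Y) (sval Z))
    (fun W X Y Z => @compA C (sval W) (sval X) (sval Y) (sval Z))
    (fun X Y => @comp1f C (sval X) (sval Y))
    (fun X Y => @compf1 C (sval X) (sval Y)).

(* The maximal oo-subgroupoid: the path components of the mapping spaces that
   consist of equivalences. *)
Definition core (C : sCat) : sCat.
Proof.
refine (@SCat C (fun X Y => vsub (@is_equiv C X Y))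
  (fun X => exist _ (idn X) (vsub_vertexP (is_equiv_idn X)))
  (fun X Y Z => vsub_map2 (@is_equiv_comp C X Y Z)) _ _ _).
- by move=> W X Y Z n h g f; apply: eq_exist; rewrite /= compA.
- by move=> X Y n [f fP]; apply: eq_exist; rewrite /= comp1f.
- by move=> X Y n [f fP]; apply: eq_exist; rewrite /= compf1.
Defined.

Definition End_monoid (C : sCat) (X : C) : sMonoid :=
  @SMonoid (hom X X) (comp X X X) (idn X) (@compA C X X X X)
    (@comp1f C X X) (@compf1 C X X).

(* The simplicial submonoid of End_monoid X on the self-equivalences of X. *)
Definition Aut_monoid (C : sCat) (X : C) : sMonoid := @End_monoid (core C) X.

Definition deloop (A : sMonoid) : sCat :=
  @SCat unit (fun _ _ => A) (fun _ => mon_one A) (fun _ _ _ => mon_mul A)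
    (fun _ _ _ _ => @mon_mulA A) (fun _ _ => @mon_mul1 A)
    (fun _ _ => @mon_1mul A).

(* The functor B End(X) -> C, corestricted to a full subcategory, sending the
   unique object to X and the identity on morphism spaces. *)
Definition deloop_incl (C : sCat) (P : C -> Prop) (X : C) (PX : P X) :
  sFunctor (deloop (End_monoid X)) (full_sub P) :=
  @SFunctor (deloop (End_monoid X)) (full_sub P) (fun _ => exist _ X PX)
    (fun _ _ => sid (hom X X)) (fun _ => erefl) (fun _ _ _ _ _ _ => erefl).

(** * Symmetric ring spectra and their modules *)

(* (block_perm s t) acts by s on the first n and by t on the last m elements. *)
Definition block_fun n m (s : 'S_n) (t : 'S_m) (i : 'I_(n + m)) : 'I_(n + m) :=
  match split i with
  | inl j => lshift m (s j)
  | inr j => rshift n (t j)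
  end.
Lemma block_fun_inj n m (s : 'S_n) (t : 'S_m) : injective (block_fun s t).
Proof.
move=> i j; rewrite /block_fun => fij; rewrite -[i]splitK -[j]splitK; move: fij.
case: (split i) => a; case: (split j) => b /= /eqP.
- by rewrite eq_lshift => /eqP/perm_inj ->.
- by rewrite eq_lrshift.
- by rewrite eq_rlshift.
- by rewrite eq_rshift => /eqP/perm_inj ->.
Qed.
Definition block_perm n m (s : 'S_n) (t : 'S_m) : 'S_(n + m) :=
  perm (@block_fun_inj n m s t).

(* chi_{n,1}, moving the last of n.+1 elements to the front: i |-> i + 1 mod
   n + 1. *)
Definition chi n : 'S_n.+1 := perm (@ordS_inj n.+1).

(* A sequence of pointed simplicial sets with actions of the symmetric groups.
   In (s * t)%g the permutation s is applied first, so pactM says that the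
   action is a left action for the usual composition of functions. *)
Record symSeq := SymSeq {
  lev :> nat -> sSet;
  pt : forall n, lev n 0;
  pact : forall n, 'S_n -> sMap (lev n) (lev n);
  pact_pt : forall n s, pact s 0 (pt n) = pt n;
  pact1 : forall n k (x : lev n k), pact 1%g k x = x;
  pactM : forall n (s t : 'S_n) k (x : lev n k),
    pact (s * t)%g k x = pact t k (pact s k x) }.

Arguments pact {s0} n s : rename.

(* The basepoint as a k-simplex. *)
Definition bpt (X : symSeq) n k : X n k := degen k (pt X n).

Definition lcast (X : symSeq) n m (e : n = m) k (x : X n k) : X m k :=
  ecast i (X i k) e x.

(* Maps out of a smash product X /\ Y are given as maps out of X * Y that send
   the wedge to the basepoint, and maps out of S^1 = Delta^1 / bdry Delta^1 as
   maps out of Delta^1 that send bdry Delta^1 to the basepoint. *)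
Record symRing := SymRing {
  rseq :> symSeq;
  rmul : forall n m, sMap (sprod (rseq n) (rseq m)) (rseq (n + m));
  rone : rseq 0 0;
  riota : sMap (simplex 1) (rseq 1);
  rmul_pt : forall n m k (x : rseq n k),
    rmul n m k (x, bpt rseq m k) = bpt rseq (n + m) k;
  rpt_mul : forall n m k (y : rseq m k),
    rmul n m k (bpt rseq n k, y) = bpt rseq (n + m) k;
  riota_bdry : forall k (t : bdry 1 k), riota k (sval t) = bpt rseq 1 k;
  rmul_perm : forall n m (s : 'S_n) (t : 'S_m) k (x : rseq n k) (y : rseq m k),
    rmul n m k (pact n s k x, pact m t k y) =
    pact (n + m) (block_perm s t) k (rmul n m k (x, y));
  rmulA : forall n m p k (x : rseq n k) (y : rseq m k) (z : rseq p k),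
    lcast (addnA n m p) (rmul n (m + p) k (x, rmul m p k (y, z))) =
    rmul (n + m) p k (rmul n m k (x, y), z);
  rmul1 : forall n k (x : rseq n k), rmul 0 n k (degen k rone, x) = x;
  r1mul : forall n k (x : rseq n k),
    lcast (addn0 n) (rmul n 0 k (x, degen k rone)) = x;
  riota_central : forall n k (t : simplex 1 k) (x : rseq n k),
    rmul 1 n k (riota k t, x) =
    pact n.+1 (chi n) k (lcast (addn1 n) (rmul n 1 k (x, riota k t))) }.

Record rmod (R : symRing) := RMod {
  mseq :> symSeq;
  mact : forall n m, sMap (sprod (mseq n) (R m)) (mseq (n + m));
  mact_pt : forall n m k (x : mseq n k),
    mact n m k (x, bpt R m k) = bpt mseq (n + m) k;
  mpt_act : forall n m k (r : R m k),
    mact n m k (bpt mseq n k, r) = bpt mseq (n + m) k;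
  mact_perm : forall n m (s : 'S_n) (t : 'S_m) k (x : mseq n k) (r : R m k),
    mact n m k (pact n s k x, pact m t k r) =
    pact (n + m) (block_perm s t) k (mact n m k (x, r));
  mactA : forall n m p k (x : mseq n k) (r : R m k) (r' : R p k),
    lcast (addnA n m p) (mact n (m + p) k (x, rmul R m p k (r, r'))) =
    mact (n + m) p k (mact n m k (x, r), r');
  mact1 : forall n k (x : mseq n k),
    lcast (addn0 n) (mact n 0 k (x, degen k (rone R))) = x }.

Definition regular (R : symRing) : rmod R :=
  @RMod R R (rmul R) (@rmul_pt R) (@rpt_mul R) (@rmul_perm R) (@rmulA R) (@r1mul R).

(** Mapping spaces *)

(* A k-simplex of map_R(M, N): a map of R-modules Delta^k_+ /\ M -> N. *)
Record map_simp (R : symRing) (M N : rmod R) (k : nat) := MapSimp {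
  ms_fun :> forall n, sMap (sprod (simplex k) (M n)) (N n);
  ms_pt : forall n j (t : simplex k j),
    ms_fun n j (t, bpt M n j) = bpt N n j;
  ms_perm : forall n (s : 'S_n) j (t : simplex k j) (x : M n j),
    ms_fun n j (t, pact n s j x) = pact n s j (ms_fun n j (t, x));
  ms_lin : forall n m j (t : simplex k j) (x : M n j) (r : R m j),
    ms_fun (n + m) j (t, mact M n m j (x, r)) =
    mact N n m j (ms_fun n j (t, x), r) }.

Lemma map_simp_eq (R : symRing) (M N : rmod R) k (f g : map_simp M N k) :
  (forall n j t (x : M n j), f n j (t, x) = g n j (t, x)) -> f = g.
Proof.
case: f g => [f f1 f2 f3] [g g1 g2 g3] /= fg.
have {}fg : f = g.
  by apply: functional_extensionality_dep => n; apply: sMap_eq => j [t x]; apply: fg.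
by subst g; congr MapSimp; apply: Prop_irrelevance.
Qed.

Definition map_simp_act (R : symRing) (M N : rmod R) k l (f : mono k l)
  (g : map_simp M N l) : map_simp M N k.
Proof.
refine (@MapSimp R M N k (fun n => scomp (g n) (sprod_simplex f (M n))) _ _ _).
- by move=> n j t; rewrite /= ms_pt.
- by move=> n s j t x; rewrite /= ms_perm.
- by move=> n m j t x r; rewrite /= ms_lin.
Defined.

Definition map_R (R : symRing) (M N : rmod R) : sSet.
Proof.
refine (@SSet (map_simp M N) (@map_simp_act R M N) _ _).
- by move=> k g; apply: map_simp_eq => n j t x; rewrite /= mono_id_comp.
- by move=> k l p f g h; apply: map_simp_eq => n j t x; rewrite /= mono_compA.
Defined.

Definition map_id (R : symRing) (M : rmod R) : map_R M M 0.
Proof.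
unshelve refine (@MapSimp R M M 0
  (fun n => @SMap (sprod (simplex 0) (M n)) (M n) (fun j tx => tx.2) _) _ _ _);
by [].
Defined.

Definition map_simp_comp (R : symRing) (L M N : rmod R) k
  (g : map_simp M N k) (f : map_simp L M k) : map_simp L N k.
Proof.
unshelve refine (@MapSimp R L N k
  (fun n => @SMap (sprod (simplex k) (L n)) (N n)
     (fun j tx => g n j (tx.1, f n j tx)) _) _ _ _).
- by move=> i j h [t x] /=; rewrite -snat /= -snat.
- by move=> n j t; rewrite /= !ms_pt.
- by move=> n s j t x; rewrite /= !ms_perm.
- by move=> n m j t x r; rewrite /= !ms_lin.
Defined.

Definition map_comp (R : symRing) (L M N : rmod R) :
  sMap (sprod (map_R M N) (map_R L M)) (map_R L N).
Proof.
refine (@SMap (sprod (map_R M N) (map_R L M)) (map_R L N)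
  (fun k gf => map_simp_comp gf.1 gf.2) _).
by move=> k l h [g f]; apply: map_simp_eq.
Defined.

Definition rmod_cat (R : symRing) : sCat.
Proof.
refine (@SCat (rmod R) (@map_R R) (@map_id R) (@map_comp R) _ _ _);
by move=> *; apply: map_simp_eq.
Defined.

(** Fibrant and cofibrant modules *)

(* Omega X = Map_*(S^1, X), with k-simplices the pointed maps
   Delta^k_+ /\ S^1 -> X. *)
Definition loops_pred (X : sSet) (x : X 0) k
  (f : sMap (sprod (simplex k) (simplex 1)) X) : Prop :=
  forall j (t : simplex k j) (u : bdry 1 j), f j (t, sval u) = degen j x.

Definition loops (X : sSet) (x : X 0) : sSet.
Proof.
unshelve refine (@SSet (fun k => {f | @loops_pred X x k f})
  (fun k l g f => exist _ (scomp (sval f) (sprod_simplex g (simplex 1))) _) _ _).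
- by move=> j t u /=; apply: (svalP f).
- move=> k [f fP]; apply: eq_exist; apply: sMap_eq => j [t u] /=.
  by rewrite mono_id_comp.
- move=> k l p g h [f fP]; apply: eq_exist; apply: sMap_eq => j [t u] /=.
  by rewrite mono_compA.
Defined.

(* The adjoint M_n -> Omega M_(n+1) of the structure map M_n /\ S^1 -> M_(n+1),
   which is x /\ t |-> x iota(t). *)
Definition structure_loop (R : symRing) (M : rmod R) n k (x : M n k) :
  loops (pt M (n + 1)) k.
Proof.
unshelve refine (exist _
  (@SMap (sprod (simplex k) (simplex 1)) (M (n + 1))
     (fun j tu => mact M n 1 j (sact (tu.1 : mono j k) x, riota R j tu.2)) _) _).
- by move=> i j f [t u] /=; rewrite -snat /= -sact_comp snat.
- by move=> j t u /=; rewrite riota_bdry mact_pt.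
Defined.

Definition adj_structure (R : symRing) (M : rmod R) n :
  sMap (M n) (loops (pt M (n + 1))).
Proof.
refine (@SMap (M n) (loops (pt M (n + 1))) (@structure_loop R M n) _).
move=> k l f x; apply: eq_exist; apply: sMap_eq => j [t u] /=.
by rewrite sact_comp.
Defined.

(* Stably fibrant: a levelwise Kan Omega-spectrum. *)
Definition fibrant (R : symRing) (M : rmod R) : Prop :=
  forall n, kan (M n) /\ weak_equiv (adj_structure M n).

Definition level_map (R : symRing) (M N : rmod R) (f : map_R M N 0) n :
  sMap (M n) (N n) :=
  scomp (f n) (spair (sconst (M n) (mono_id 0 : simplex 0 0)) (sid (M n))).

(* The trivial fibrations of the stable model structure are the levelwise
   trivial fibrations. *)
Definition cofibrant (R : symRing) (M : rmod R) : Prop :=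
  forall (X Y : rmod R) (p : map_R X Y 0) (f : map_R M Y 0),
  (forall n, trivial_fibration (level_map p n)) ->
  exists g : map_R M X 0, map_simp_comp p g = f.

Record AooRing := {
  aoo_ring :> symRing;
  aoo_fibrant : fibrant (regular aoo_ring) }.

Definition Mod (R : AooRing) : sCat :=
  @full_sub (rmod_cat R) (fun M => cofibrant M /\ fibrant M).

(** R is a cofibrant module over itself *)

Lemma lcast_id (X : symSeq) n (e : n = n) k (x : X n k) : lcast e x = x.
Proof. by rewrite (eq_irrelevance e erefl). Qed.

Lemma block_perm0 n (s : 'S_n) : block_perm (1%g : 'S_0) s = s :> 'S_n.
Proof.
apply/permP => i; rewrite permE /block_fun.
case: splitP => [[]//|j ij]; apply: val_inj => /=.
by rewrite add0n; congr (val (s _)); apply: val_inj; rewrite /= ij.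
Qed.

(* The map R -> M of modules that sends 1 to v. *)
Definition free_map (R : symRing) (M : rmod R) (v : M 0 0) :
  map_R (regular R) M 0.
Proof.
unshelve refine (@MapSimp R (regular R) M 0
  (fun n => @SMap (sprod (simplex 0) (R n)) (M n)
     (fun j tx => mact M 0 n j (degen j v, tx.2)) _) _ _ _).
- by move=> i j f [t x] /=; rewrite -snat /= degen_act.
- by move=> n j t /=; rewrite mact_pt.
- move=> n s j t x /=.
  by rewrite -[in LHS](pact1 (degen j v)) mact_perm block_perm0.
- move=> n m j t x r /=.
  have := mactA (degen j v) x r.
  by rewrite (lcast_id (addnA 0 n m : n + m = n + m)).
Defined.

Lemma simplex0_eq j (s t : simplex 0 j) : s = t.
Proof. by apply: mono_eq => i; rewrite (ord1 (s i)) (ord1 (t i)). Qed.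

Lemma cofibrant_regular (R : symRing) : cofibrant (regular R).
Proof.
move=> X Y p f pP.
set y : Y 0 0 := f 0 0 (mono_id 0, rone R).
pose d : sMap (simplex 0) (Y 0) := sconst (simplex 0) y.
have noB m (t : bdry 0 m) : False.
  by case: t => t [j tj]; apply: (tj ord0); rewrite (ord1 j) (ord1 (t _)).
have bn m n (t : mono m n) (u : bdry 0 n) :
  False_rect (X 0 m) (noB m (sact t u)) = sact t (False_rect (X 0 n) (noB n u)).
  by case: (noB n u).
have [|H [_ HP]] := pP 0 0 (SMap (fun m u => False_rect _ (noB m u)) bn) d.
  by move=> m u; case: (noB m u).
pose x : X 0 0 := H 0 (mono_id 0).
exists (free_map x); apply: map_simp_eq => n j t r /=.
rewrite -[X 0 0]/(mseq X 0 0) in x *.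
rewrite (ms_lin p t (degen j x) r).
have -> : p 0 j (t, degen j x) = degen j y.
  have := HP 0 (mono_id 0); rewrite /= degen0 => pxy.
  have -> : degen j y = degen j (d 0 (mono_id 0)) by rewrite /= degen0.
  rewrite /= degen0 -pxy /degen -snat /=; congr (p 0 j (_, _)).
  exact: simplex0_eq.
have -> : degen j y = f 0 j (t, degen j (rone R)).
  rewrite /y /degen -snat /=; congr (f 0 j (_, _)); exact: simplex0_eq.
rewrite -(ms_lin f t (degen j (rone R) : regular R 0 j) r) /=.
by rewrite rmul1.
Qed.

(** * Lines and units *)

Definition R_mod (R : AooRing) : Mod R :=
  exist _ (regular R) (conj (@cofibrant_regular (aoo_ring R)) (@aoo_fibrant R)).

Definition is_line (R : AooRing) (M : Mod R) : Prop := equivalent M (R_mod R).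

Definition Line (R : AooRing) : sCat := @full_sub (core (Mod R)) (@is_line R).

Definition Aut (R : AooRing) : sMonoid := Aut_monoid (R_mod R).

Definition BAut (R : AooRing) : sCat := deloop (Aut R).

Lemma is_line_R (R : AooRing) : is_line (R_mod R).
Proof. by exists (idn _); apply: is_equiv_idn. Qed.

Definition BAut_to_Line (R : AooRing) : sFunctor (BAut R) (Line R) :=
  @deloop_incl (core (Mod R)) (@is_line R) (R_mod R) (is_line_R R).

(* For a stably fibrant R, the space Omega^oo R is R_0, with its multiplication
   R_0 * R_0 -> R_(0 + 0) = R_0, and pi_0(R) = pi_0(R_0). *)
Definition Omega_oo (R : AooRing) : sMonoid.
Proof.
refine (@SMonoid (R 0) (rmul R 0 0) (rone R) _ _ _).
- move=> n x y z; have := @rmulA R 0 0 0 n x y z.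
  by rewrite (lcast_id (addnA 0 0 0 : 0 = 0)).
- by move=> n x; apply: rmul1.
- move=> n x; have := @r1mul R 0 n x.
  by rewrite (lcast_id (addn0 0 : 0 = 0)).
Defined.

Lemma GL1_mul (R : AooRing) (x y : Omega_oo R 0) :
  pi0_unit (pi0_class x : pi0 (Omega_oo R)) ->
  pi0_unit (pi0_class y : pi0 (Omega_oo R)) ->
  pi0_unit (pi0_class (mon_mul (Omega_oo R) 0 (x, y)) : pi0 (Omega_oo R)).
Proof. by rewrite -pi0_mulE; apply: pi0_unit_mul. Qed.

(* The pullback of Omega^oo R -> pi_0(R) <- pi_0(R)^x; all vertices of a simplex
   have the same class in pi_0(R). *)
Definition GL1 (R : AooRing) : sMonoid :=
  @sub_monoid (Omega_oo R) (fun x => pi0_unit (pi0_class x))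
    (pi0_unit_one (Omega_oo R)) (@GL1_mul R).

(* Main.v *)
(* Evaluation at 1 is an isomorphism of simplicial sets map_R(R, M) -> M_0, with
   inverse v |-> (x |-> v x).  For M = R it is an isomorphism of simplicial monoids
   End_R(R) -> Omega^oo R, under which the equivalences correspond to the units
   of pi_0(R).  For the first claim, being an equivalence is invariant under
   paths, so an inverse of a morphism of the core, with its two homotopies, lies
   in the core again.  Hence the core is a groupoid, and its full subcategory of
   lines has all objects equivalent to R. *)

Require Import Defs.
From Stdlib Require Import Relation_Operators.
From mathcomp Require Import all_boot boolp.

Set Implicit Arguments.
Unset Strict Implicit.
Unset Printing Implicit Defensive.

(** * Full simplicial subsets and weak equivalences *)

Lemma vertex0 (X : sSet) (i : 'I_1) (x : X 0) : vertex i x = x.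
Proof. by rewrite (ord1 i); apply: degen0. Qed.

Lemma vsub_0P (X : sSet) (P : X 0 -> Prop) (x : vsub P 0) : P (sval x).
Proof. by have := svalP x ord0; rewrite vertex0. Qed.

Lemma vsub_eq (X : sSet) (P : X 0 -> Prop) n (x y : vsub P n) :
  sval x = sval y -> x = y.
Proof. by case: x y => [x Px] [y Py] /= xy; apply: eq_exist. Qed.

(** A zigzag of edges that starts in [P] stays in [P], so each of its edges has both endpoints in
    [P] and is a simplex of [vsub P]. *)
Lemma connected_vsub (X : sSet) (P : X 0 -> Prop) :
  (forall x y, connected x y -> P x -> P y) ->
  forall x y : vsub P 0, connected (sval x) (sval y) -> connected x y.
Proof.
move=> Pconn.
(* The induction runs in [X], because the intermediate vertices of a zigzag carry no proof of
   [P]. *)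
suff H (a b : X 0) : connected a b ->
    forall x y : vsub P 0, sval x = a -> sval y = b -> connected x y.
  by move=> x y xy; apply: (H _ _ xy).
elim=> {a b} [a b [e [ea eb]] x y xa yb|a x y xa ya|a b _ IH x y xb ya
             |a b c ab IH _ IH' x y xa yc].
- apply: rst_step.
  have eP (i : 'I_2) : P (vertex i e).
    case: (unliftP ord0 i) => [j|] ->; last by rewrite ea -xa; apply: vsub_0P.
    rewrite (_ : lift _ _ = ord_max); last by apply: val_inj; rewrite (ord1 j).
    by rewrite eb -yb; apply: vsub_0P.
  by exists (exist _ e eP); split; apply: vsub_eq; rewrite ?xa ?yb.
- by rewrite (_ : x = y); [apply: rst_refl|apply: vsub_eq; rewrite xa].
- by apply: rst_sym; apply: IH.
- have Pb : P b by apply: Pconn ab _; rewrite -xa; apply: vsub_0P.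
  pose z : vsub P 0 := exist _ b (vsub_vertexP Pb).
  by apply: (@rst_trans _ _ _ z); [apply: IH|apply: IH'].
Qed.

Lemma homotopic_scomp X Y Z (h h' : sMap Y Z) (f : sMap X Y) :
  homotopic h h' -> homotopic (scomp h f) (scomp h' f).
Proof.
elim=> {h h'} [h h' [H HP]|h|h h' _ IH|h h' h'' _ IH _ IH'].
- apply: rst_step.
  unshelve eexists (@SMap (sprod (simplex 1) X) Z (fun n tx => H n (tx.1, f n tx.2)) _).
    by move=> m n t [u x] /=; rewrite snat -[in RHS]snat.
  by move=> n x; apply: HP.
- exact: rst_refl.
- exact: rst_sym.
- exact: rst_trans IH IH'.
Qed.

(** Precomposition with [g] inverts precomposition with [f], and both respect homotopy. *)
Lemma weak_equiv_iso X Y (f : sMap X Y) (g : sMap Y X) :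
  (forall n x, g n (f n x) = x) -> (forall n y, f n (g n y) = y) -> weak_equiv f.
Proof.
move=> gK fK Z _; split=> [h|h h' hh'].
  exists (scomp h g); rewrite (_ : scomp _ f = h); first exact: rst_refl.
  by apply: sMap_eq => n x /=; rewrite gK.
have fgK (k : sMap Y Z) : scomp (scomp k f) g = k.
  by apply: sMap_eq => n y /=; rewrite fK.
by rewrite -(fgK h) -(fgK h'); apply: homotopic_scomp.
Qed.

Lemma weak_equiv_sid X : weak_equiv (sid X).
Proof. exact: (@weak_equiv_iso _ _ _ (sid X)). Qed.

(** * Equivalences in cores and deloopings *)

Lemma is_equiv_connected (C : sCat) (X Y : C) (f f' : hom X Y 0) :
  connected f f' -> is_equiv f -> is_equiv f'.
Proof.
move=> ff' [g [gf fg]]; exists g.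
split; [apply: rst_trans gf | apply: rst_trans fg];
  apply: connected_map2; try exact: rst_refl; exact: rst_sym.
Qed.

Lemma core_is_groupoid (C : sCat) : is_groupoid (core C).
Proof.
move=> X Y f; have [g [gf fg]] := vsub_0P f.
have gP : is_equiv g by exists (sval f).
exists (exist _ g (vsub_vertexP gP)).
by split; apply: connected_vsub => //; apply: is_equiv_connected.
Qed.

Lemma full_sub_is_groupoid (C : sCat) (P : C -> Prop) :
  is_groupoid C -> is_groupoid (full_sub P).
Proof. by move=> CP X Y f; apply: (CP (sval X) (sval Y) f). Qed.

Lemma deloop_End_is_groupoid (C : sCat) (X : C) :
  is_groupoid C -> is_groupoid (deloop (End_monoid X)).
Proof. by move=> CP [] [] f; apply: (CP X X f). Qed.

(** The functor is the identity on mapping spaces, so only essential surjectivity has content. *)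
Lemma deloop_incl_dk_equiv (C : sCat) (P : C -> Prop) (X : C) (PX : P X) :
  (forall Y, P Y -> equivalent X Y) -> dk_equiv (deloop_incl PX).
Proof.
move=> PE; split=> [? ?|[Y PY]]; first exact: weak_equiv_sid.
by exists tt; apply: (PE Y PY).
Qed.

Lemma equivalent_core (C : sCat) (X Y : C) :
  equivalent X Y -> @equivalent (core C) X Y.
Proof.
by move=> [f fP]; exists (exist _ f (vsub_vertexP fP)); apply: core_is_groupoid.
Qed.

Lemma equivalent_sym (C : sCat) (X Y : C) : equivalent X Y -> equivalent Y X.
Proof. by move=> [f [g [gf fg]]]; exists g, f. Qed.

(** Reading units as equivalences of the delooping lets functors transport them. *)
Lemma pi0_unitP (A : sMonoid) (a : A 0) :
  pi0_unit (pi0_class a) <-> @is_equiv (deloop A) tt tt a.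
Proof.
split=> [[c] | [b [ba ab]]].
- rewrite -(pi0_reprK c) !pi0_mulE => -[/pi0_classP ab /pi0_classP ba].
  by exists (pi0_repr c).
- by exists (pi0_class b); rewrite !pi0_mulE; split; apply/pi0_classP.
Qed.

Lemma sFunctor_is_equiv (C D : sCat) (F : sFunctor C D) (X Y : C) (f : hom X Y 0) :
  is_equiv f -> is_equiv (fhom F X Y 0 f).
Proof.
by move=> [g [gf fg]]; exists (fhom F Y X 0 g); rewrite -!fcomp -!fidn;
  split; apply: connected_map.
Qed.

Definition deloop_hom (A B : sMonoid) (f : sMonHom A B) :
  sFunctor (deloop A) (deloop B) :=
  @SFunctor (deloop A) (deloop B) id (fun _ _ => f)
    (fun _ => hom_one f) (fun _ _ _ => hom_mul f).

(** * Evaluation at 1 and its inverse *)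

Definition eval_one (R : symRing) (M : rmod R) : sMap (map_R (regular R) M) (M 0).
Proof.
refine (@SMap (map_R (regular R) M) (M 0)
  (* A map out of [simplex k] is determined by its value at the universal simplex [mono_id k]. *)
  (fun k f => f 0 k (mono_id k : simplex k k, degen k (rone R))) _).
move=> k l t f /=; rewrite -snat /= degen_act mono_comp_id mono_id_comp.
by [].
Defined.

(** This extends [free_map] to higher simplices: over a simplex [t] of [simplex k], the multiplier
    is the restriction of [v] along [t]. *)
Definition mul_left_simp (R : symRing) (M : rmod R) k (v : M 0 k) :
  map_simp (regular R) M k.
Proof.
unshelve refine (@MapSimp R (regular R) M k
  (fun n => @SMap (sprod (simplex k) (R n)) (M n)
     (fun j tx => mact M 0 n j (sact (tx.1 : mono j k) v, tx.2)) _) _ _ _).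
- by move=> i j f [t x] /=; rewrite -snat /= sact_comp.
- by move=> n j t /=; rewrite mact_pt.
- move=> n s j t x /=.
  by rewrite -[in LHS](pact1 (sact _ v)) mact_perm block_perm0.
- move=> n m j t x r /=.
  have := mactA (sact (t : mono j k) v) x r.
  by rewrite (lcast_id (addnA 0 n m : n + m = n + m)).
Defined.

Definition mul_left (R : symRing) (M : rmod R) : sMap (M 0) (map_R (regular R) M).
Proof.
refine (@SMap (M 0) (map_R (regular R) M) (@mul_left_simp R M) _).
by move=> k l t v; apply: map_simp_eq => n j u x /=; rewrite sact_comp.
Defined.

Lemma mul_leftK (R : symRing) (M : rmod R) k (v : M 0 k) :
  eval_one M k (mul_left M k v) = v.
Proof.
have := mact1 v; rewrite (lcast_id (addn0 0 : 0 = 0)) => {2}<- /=.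
by rewrite sact_id.
Qed.

(** Linearity applied to [x = 1 x] reduces to the value at [(t, 1)], which by naturality is the
    restriction along [t] of the value at [(mono_id k, 1)]. *)
Lemma map_simp_eval_one (R : symRing) (M : rmod R) k
  (f : map_R (regular R) M k) n j (t : simplex k j) (x : R n j) :
  f n j (t, x) = mact M 0 n j (sact (t : mono j k) (eval_one M k f), x).
Proof.
rewrite -[in LHS](rmul1 x).
have /= -> := ms_lin f t (degen j (rone R) : regular R 0 j) x.
by rewrite -[in RHS]snat /= degen_act mono_id_comp.
Qed.

Lemma eval_oneK (R : symRing) (M : rmod R) k (f : map_R (regular R) M k) :
  mul_left M k (eval_one M k f) = f.
Proof. by apply: map_simp_eq => n j t x; rewrite [RHS]map_simp_eval_one. Qed.

Definition End_to_Omega (R : AooRing) : sMonHom (End_monoid (R_mod R)) (Omega_oo R).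
Proof.
refine (@SMonHom (End_monoid (R_mod R)) (Omega_oo R) (eval_one (regular R)) _ _).
- move=> k g f /=; rewrite [LHS]map_simp_eval_one.
  by rewrite (sact_id (eval_one (regular R) k g)).
- by rewrite /= degen0.
Defined.

Definition Omega_to_End (R : AooRing) : sMonHom (Omega_oo R) (End_monoid (R_mod R)).
Proof.
refine (@SMonHom (Omega_oo R) (End_monoid (R_mod R)) (mul_left (regular R)) _ _).
(* The inverse of a bijective homomorphism is multiplicative: both sides are compared after
   evaluation at 1. *)
- move=> k x y; rewrite -[RHS]eval_oneK; congr (mul_left _ _ _).
  rewrite [RHS](hom_mul (End_to_Omega R)).
  by congr (mon_mul (Omega_oo R) k (_, _)); rewrite [RHS](mul_leftK (M := regular R)).
- rewrite -[RHS]eval_oneK; congr (mul_left _ _ _).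
  by rewrite [RHS](hom_one (End_to_Omega R)).
Defined.

Lemma End_to_OmegaK (R : AooRing) k (f : End_monoid (R_mod R) k) :
  Omega_to_End R k (End_to_Omega R k f) = f.
Proof. exact: (eval_oneK (M := regular R)). Qed.

Lemma Omega_to_EndK (R : AooRing) k (x : Omega_oo R k) :
  End_to_Omega R k (Omega_to_End R k x) = x.
Proof. exact: (mul_leftK (M := regular R)). Qed.

(** Functors preserve equivalences; the deloopings of the two mutually inverse homomorphisms give
    the two directions. *)
Lemma End_to_Omega_unit (R : AooRing) (f : End_monoid (R_mod R) 0) :
  is_equiv f <-> pi0_unit (pi0_class (End_to_Omega R 0 f)).
Proof.
rewrite pi0_unitP; split=> [fP | /(sFunctor_is_equiv (deloop_hom (Omega_to_End R)))].
  exact: (sFunctor_is_equiv (deloop_hom (End_to_Omega R)) fP).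
by rewrite [fhom _ _ _ _ _]End_to_OmegaK.
Qed.

Definition vsub_map (X Y : sSet) (P : X 0 -> Prop) (Q : Y 0 -> Prop) (f : sMap X Y)
  (fP : forall x, P x -> Q (f 0 x)) : sMap (vsub P) (vsub Q).
Proof.
unshelve refine (@SMap (vsub P) (vsub Q) (fun n x => exist _ (f n (sval x)) _) _).
- by move=> i /=; rewrite vertex_map; apply: fP; apply: (svalP x).
- by move=> m n t [x Px]; apply: eq_exist; rewrite /= snat.
Defined.

Definition Aut_to_GL1 (R : AooRing) : sMonHom (Aut R) (GL1 R).
Proof.
refine (@SMonHom (Aut R) (GL1 R)
  (vsub_map (fun f => proj1 (@End_to_Omega_unit R f))) _ _).
- by move=> k f g; apply: eq_exist; apply: (hom_mul (End_to_Omega R)).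
- by apply: eq_exist; apply: (hom_one (End_to_Omega R)).
Defined.

Lemma Aut_to_GL1_weak_equiv (R : AooRing) : weak_equiv (Aut_to_GL1 R).
Proof.
(* This lets [Omega_to_End] restrict to an inverse of [Aut_to_GL1]. *)
have gP (v : Omega_oo R 0) :
    pi0_unit (pi0_class v) -> is_equiv (Omega_to_End R 0 v).
  by move=> vP; apply/End_to_Omega_unit; rewrite Omega_to_EndK.
apply: (weak_equiv_iso (g := vsub_map gP)) => n [x Px]; apply: eq_exist.
- exact: End_to_OmegaK.
- exact: Omega_to_EndK.
Qed.

Theorem proposition2p9 (R : AooRing) :
  groupoid_equiv (BAut_to_Line R) /\ monoidal_equiv (Aut R) (GL1 R).
Proof.
split; last by apply: rst_step; exists (Aut_to_GL1 R); apply: Aut_to_GL1_weak_equiv.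
(* By definition [Aut R] is an endomorphism monoid in the core. *)
split; first exact/deloop_End_is_groupoid/core_is_groupoid.
  exact/full_sub_is_groupoid/core_is_groupoid.
(* A line comes with an equivalence to [R] in [Mod R]; essential surjectivity asks for one from [R]
   in the core. *)
apply: deloop_incl_dk_equiv => M /equivalent_sym.
exact: equivalent_core.
Qed.
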